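(* Let $\ell$ be a positive integer with $\ell<4$. Then there exists no graph $G$ with an edge $e\in E(G)$ such that $\gamma_g'(G)=\ell$ and $\gamma_g'(G-e)=\ell-1$.
   Context: Graphs are finite, simple and undirected. A vertex dominates itself and all its neighbors. The domination game on a graph $G$ is played by two players, Dominator and Staller, who alternately choose a vertex of $G$ such that each chosen vertex dominates at least one vertex that was not dominated by the previously chosen vertices. The game ends when all vertices of $G$ are dominated. Dominator wants the total number of chosen vertices to be as small as possible, Staller wants it to be as large as possible. Assuming both play optimally, $\gamma_g'(G)$ (the Staller-start game domination number) is the total number of vertices chosen when Staller moves first. $G-e$ denotes the graph obtained from $G$ by removing the edge $e$ (keeping all vertices). *)

(* Defs.v *)
From mathcomp Require Import all_boot.

Set Implicit Arguments.
Unset Strict Implicit.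
Unset Printing Implicit Defensive.

Record sgraph (T : finType) := SGraph {
  adj : rel T;
  adj_sym : symmetric adj;
  adj_irr : irreflexive adj }.

Section Graph.
Variables (T : finType) (G : sgraph T).

Definition edges : {set {set T}} :=
  [set [set p.1; p.2] | p : T * T & adj G p.1 p.2].

Definition del_adj (e : {set T}) : rel T :=
  fun x y => adj G x y && ([set x; y] != e).

Lemma del_adj_sym e : symmetric (del_adj e).
Proof. by move=> x y; rewrite /del_adj adj_sym setUC. Qed.

Lemma del_adj_irr e : irreflexive (del_adj e).
Proof. by move=> x; rewrite /del_adj adj_irr. Qed.

Definition del_edge (e : {set T}) : sgraph T :=
  SGraph (del_adj_sym e) (del_adj_irr e).

Definition closed_nbhd (v : T) : {set T} := [set w | (w == v) || adj G v w].

Definition dominated (S : {set T}) : {set T} := \bigcup_(v in S) closed_nbhd v.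

Definition legal (S : {set T}) (v : T) : bool :=
  ~~ (closed_nbhd v \subset dominated S).

End Graph.

Inductive player := Dominator | Staller.

Definition opponent (p : player) : player :=
  if p is Dominator then Staller else Dominator.

Section Game.
Variables (T : finType) (G : sgraph T).

(* Minimax value of the position where the vertices of S have been chosen and
   p is to move; the payoff is the total number of chosen vertices, those in S
   included.  The recursion depth n is immaterial once n >= #|~: S|, because a
   legal move is never in S (see [game_valueE]).  The unit #|T| of the minimum
   bounds all payoffs, so it does not affect the minimum over a nonempty set of
   moves (see [game_value_dominator]). *)
Fixpoint minimax (n : nat) (p : player) (S : {set T}) : nat :=
  if n is n'.+1 then
    if dominated G S == [set: T] then #|S|
    else match p with
         | Dominator =>
             \big[minn/#|T|]_(v | legal G S v) minimax n' Staller (v |: S)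
         | Staller =>
             \max_(v | legal G S v) minimax n' Dominator (v |: S)
         end
  else #|S|.

Definition game_value (p : player) (S : {set T}) : nat := minimax #|~: S| p S.

Definition gamma_g' : nat := game_value Staller set0.

Lemma legal_notin (S : {set T}) v : legal G S v -> v \notin S.
Proof. by apply: contra => vS; apply: (bigcup_sup v). Qed.

Lemma legal_exists S : dominated G S != [set: T] -> exists v, legal G S v.
Proof.
rewrite -subTset => /subsetPn [v _ nd]; exists v.
by apply/subsetPn; exists v => //; rewrite inE eqxx.
Qed.

Lemma card_setC_move (S : {set T}) (v : T) : v \notin S -> #|~: S| = #|~: (v |: S)|.+1.
Proof.
by move=> vS; rewrite setCU setIC -setDE (cardsD1 v (~: S)) inE vS.
Qed.

Lemma minimax_le n p S : minimax n p S <= #|T|.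
Proof.
elim: n p S => [|n IH] p S /=; first exact: max_card.
case: ifP => _; first exact: max_card.
case: p; last by apply/bigmax_leqP => v _; apply: IH.
elim/big_rec: _ => // v m _ _; apply: leq_trans (geq_minl _ _) (IH _ _).
Qed.

Lemma game_valueE p S :
  game_value p S =
    if dominated G S == [set: T] then #|S|
    else match p with
         | Dominator =>
             \big[minn/#|T|]_(v | legal G S v) game_value Staller (v |: S)
         | Staller =>
             \max_(v | legal G S v) game_value Dominator (v |: S)
         end.
Proof.
rewrite /game_value; case E: #|~: S| => [|n] /=.
  case: ifPn => // /legal_exists [v /legal_notin /card_setC_move].
  by rewrite E.
case: ifP => // _; case: p; apply: eq_bigr => v /legal_notin /card_setC_move;
  by rewrite E => -[->].
Qed.

Lemma game_value_dominator S : dominated G S != [set: T] ->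
  (forall v, legal G S v ->
     game_value Dominator S <= game_value Staller (v |: S)) /\
  (exists2 v, legal G S v &
     game_value Dominator S = game_value Staller (v |: S)).
Proof.
move=> nd; rewrite game_valueE (negPf nd).
set F := fun v => game_value Staller (v |: S).
have [v0 Lv0] := legal_exists nd.
have [w Lw wmin] := @arg_minnP _ v0 (legal G S) F Lv0.
have le v : legal G S v -> \big[minn/#|T|]_(u | legal G S u) F u <= F v.
  move=> Lv; have: v \in index_enum T by rewrite mem_index_enum.
  elim: (index_enum T) => // u r IH; rewrite inE big_cons.
  case/predU1P => [<-|/IH le_r]; first by rewrite Lv geq_minl.
  by case: ifP => // _; rewrite geq_min le_r orbT.
split=> //; exists w => //; apply/eqP; rewrite eqn_leq le //=.
elim/big_ind: _ => [|m1 m2 h1 h2|v Lv]; first exact: minimax_le.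
- by rewrite leq_min h1.
- exact: wmin.
Qed.

End Game.

(* Main.v *)
Require Import Defs.
From mathcomp Require Import all_boot.

Set Implicit Arguments.
Unset Strict Implicit.
Unset Printing Implicit Defensive.

(** Deleting an edge can only make closed neighbourhoods smaller.  A Staller-start
game of length at most two is decided by a condition of the form "every vertex,
alone or together with a suitable second one, dominates the graph", and such a
condition passes from [G - e] to [G].  Hence [gamma_g' (G - e) <= 2] forces
[gamma_g' G <= gamma_g' (G - e)]. *)

Section GameValueBounds.
Variables (T : finType) (G : sgraph T).
Implicit Types (p : player) (S : {set T}) (v : T).

Lemma dominatedU1 S v :
  dominated G (v |: S) = closed_nbhd G v :|: dominated G S.
Proof. by rewrite /dominated bigcup_setU big_set1. Qed.

Lemma legal_set0 v : legal G set0 v.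
Proof.
rewrite /legal /dominated big_set0 subset0; apply/set0Pn.
by exists v; rewrite inE eqxx.
Qed.

Lemma card_legalU1 S v : legal G S v -> #|v |: S| = #|S|.+1.
Proof. by move=> /legal_notin vS; rewrite cardsU1 vS. Qed.

Lemma game_value_ge p S : #|S| <= game_value G p S.
Proof.
rewrite /game_value; move: #|~: S| => n; elim: n p S => [|n IH] p S //=.
case: ifPn => // /legal_exists [v Lv].
have IHU q u : #|S| <= minimax G n q (u |: S).
  exact: leq_trans (subset_leq_card (subsetUr _ _)) (IH q _).
case: p; last by apply: leq_trans (leq_bigmax_cond v Lv); apply: IHU.
by elim/big_ind: _ => [|a b ha hb|u _]; rewrite ?max_card ?leq_min ?ha.
Qed.

(** While [S] is not dominating, some legal move remains, and it adds a new vertex to [S]. *)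
Lemma game_value_le_card p S :
  (game_value G p S <= #|S|) = (dominated G S == setT).
Proof.
apply/idP/idP => [|dS]; last by rewrite game_valueE dS.
apply: contraLR => nd; rewrite -ltnNge.
case: p; last first.
  rewrite game_valueE (negPf nd); have [v Lv] := legal_exists nd.
  apply: leq_trans (leq_bigmax_cond v Lv).
  by rewrite -(card_legalU1 Lv) game_value_ge.
have [_ [v Lv ->]] := game_value_dominator nd.
by rewrite -(card_legalU1 Lv) game_value_ge.
Qed.

End GameValueBounds.

Section SpanningSubgraph.
Variables (T : finType) (G H : sgraph T).
Hypothesis sHG : subrel (adj H) (adj G).

Lemma dominated_subgraph (S : {set T}) : dominated H S \subset dominated G S.
Proof.
apply/bigcupsP => v vS; apply: subset_trans (bigcup_sup v vS).
apply/subsetP => w; rewrite !inE.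
by case/predU1P => [->|/sHG ->]; rewrite ?eqxx ?orbT.
Qed.

Lemma dominated_subgraphT (S : {set T}) :
  dominated H S == setT -> dominated G S == setT.
Proof. by rewrite -!subTset => /subset_trans; apply; apply: dominated_subgraph. Qed.

(** The bound on [k] leaves Dominator at most one move in [H]; the vertex that ends the game there
    also ends it in [G]. *)
Lemma game_value_dominator_subgraph k (S : {set T}) : k <= #|S|.+1 ->
  game_value H Dominator S <= k -> game_value G Dominator S <= k.
Proof.
move=> kS Hk; have [dG|ndG] := boolP (dominated G S == setT).
  rewrite game_valueE dG; exact: leq_trans (game_value_ge H Dominator S) Hk.
have ndH : dominated H S != setT := contra (@dominated_subgraphT S) ndG.
(* [S] does not dominate [H], so at least one more move is needed there. *)
have Sk : k = #|S|.+1.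
  apply/eqP; rewrite eqn_leq kS /=; apply: leq_trans Hk.
  by rewrite ltnNge game_value_le_card.
have [_ [w Lw Ew]] := game_value_dominator ndH.
have cw := card_legalU1 Lw.
have dGw : dominated G (w |: S) == setT.
  apply: dominated_subgraphT.
  by rewrite -(game_value_le_card H Staller) cw -Sk -Ew.
(* An illegal [w] would dominate nothing new, so [S] alone would already dominate [G]. *)
have LGw : legal G S w.
  by apply: contra ndG => /setUidPr <-; rewrite -dominatedU1.
have [/(_ w LGw) le_w _] := game_value_dominator ndG.
by apply: leq_trans le_w _; rewrite Sk -cw game_value_le_card.
Qed.

(** Every vertex is a legal first move in both graphs, so Staller's opening in [G] can be copied in
    [H]. One vertex is then chosen, and [k <= 2] leaves room for a single reply. *)
Lemma gamma_g'_subgraph k : k <= 2 -> gamma_g' H <= k -> gamma_g' G <= k.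
Proof.
rewrite /gamma_g' => k2 Hk; rewrite game_valueE; case: ifPn => [_|ndG].
  by rewrite cards0.
apply/bigmax_leqP => v _; apply: game_value_dominator_subgraph.
  by rewrite setU0 cards1.
move: Hk; rewrite game_valueE.
rewrite (negPf (contra (@dominated_subgraphT set0) ndG)).
by move/bigmax_leqP; apply; apply: legal_set0.
Qed.

End SpanningSubgraph.

Theorem mainTheorem17 (l : nat) (l_pos : 0 < l) (l_lt4 : l < 4) :
  ~ (exists (T : finType) (G : sgraph T) (e : {set T}),
       [/\ e \in edges G, gamma_g' G = l & gamma_g' (del_edge G e) = l - 1]).
Proof.
case=> T [G [e [_ EG EH]]].
have sHG : subrel (adj (del_edge G e)) (adj G) by move=> x y /andP[].
have: gamma_g' G <= l - 1.
  apply: (gamma_g'_subgraph sHG); last by rewrite EH.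
  (* [l < 4] enters here, as [l - 1 <= 2]. *)
  by rewrite leq_subLR.
by rewrite EG subn1 leqNgt ltn_predL l_pos.
Qed.
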